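(* Let $(X,D,P)$ be a complete perturbed metric space with exact metric $d=D-P$, and let $M\ge 1$ be a constant such that $D(x,y)\le M\,d(x,y)$ for all $x,y\in X$. Let $T:X\to X$ and $b\ge 0$ satisfy $$D(Tx,Ty)\le b\,\bigl(D(x,Tx)+D(y,Ty)\bigr),\qquad x,y\in X,$$ and $2Mb<1$. Then $T$ has a unique fixed point, and for every $x_0\in X$ the Picard iteration $x_{n+1}=Tx_n$ converges to it in $(X,d)$.
   Context: A perturbed metric space $(X,D,P)$ consists of a nonempty set $X$ and two functions $D,P:X\times X\to[0,\infty)$ such that $d(x,y):=D(x,y)-P(x,y)$ is a metric on $X$, called the exact metric. Neither $D$ nor $P$ is assumed symmetric. $(X,D,P)$ is called complete if the metric space $(X,d)$ is complete. *)

(* Defs.v *)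
From HB Require Import structures.
From mathcomp Require Import all_boot all_order all_algebra.
From mathcomp Require Import boolp classical_sets reals topology.

Set Implicit Arguments.
Unset Strict Implicit.
Unset Printing Implicit Defensive.

Import Order.TTheory GRing.Theory Num.Theory.

Local Open Scope classical_set_scope.
Local Open Scope ring_scope.

Record is_metric (R : realType) (X : Type) (d : X -> X -> R) : Prop := IsMetric {
  is_metric_ge0 : forall x y, 0 <= d x y;
  is_metric_eq0 : forall x y, d x y = 0 <-> x = y;
  is_metric_sym : forall x y, d x y = d y x;
  is_metric_triangle : forall x y z, d x z <= d x y + d y z
}.

(* Neither pdist nor perturbation is assumed symmetric or zero on the
   diagonal: only their difference is a metric. *)
Record perturbedMetricSpace (R : realType) := PerturbedMetricSpace {
  pm_sort :> Type;
  pdist : pm_sort -> pm_sort -> R;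
  perturbation : pm_sort -> pm_sort -> R;
  pm_nonempty : [set: pm_sort] !=set0;
  pdist_ge0 : forall x y, 0 <= pdist x y;
  perturbation_ge0 : forall x y, 0 <= perturbation x y;
  exact_metricP : is_metric (fun x y => pdist x y - perturbation x y)
}.

Definition exact_metric (R : realType) (X : perturbedMetricSpace R) (x y : X) : R :=
  pdist x y - perturbation x y.

(* The carrier is given the metric structure of the exact metric, so that
   cauchy, cvg and --> on it refer to (X, d). *)
Section exact_metric_structure.
Context (R : realType) (X : perturbedMetricSpace R).

Let exact_metricxx (x : X) : exact_metric x x = 0.
Proof. exact/(is_metric_eq0 (exact_metricP X)). Qed.

Let exact_metric_positivity (x y : X) : exact_metric x y = 0 -> x = y.
Proof. by move/(is_metric_eq0 (exact_metricP X)). Qed.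

Let exact_metric_sym (x y : X) : exact_metric x y = exact_metric y x.
Proof. exact: (is_metric_sym (exact_metricP X)). Qed.

Let exact_metric_triangle (y x z : X) :
  exact_metric x z <= exact_metric x y + exact_metric y z.
Proof. exact: (is_metric_triangle (exact_metricP X)). Qed.

HB.instance Definition _ := gen_eqMixin (pm_sort X).
HB.instance Definition _ := gen_choiceMixin (pm_sort X).
HB.instance Definition _ := @isMetric.Build R (pm_sort X) (@exact_metric R X)
  exact_metricxx exact_metric_positivity exact_metric_sym exact_metric_triangle.

End exact_metric_structure.

Lemma mdist_exact (R : realType) (X : perturbedMetricSpace R) (x y : X) :
  mdist x y = exact_metric x y.
Proof. by []. Qed.

(* Sequential completeness: the library's completeType bundles a distinguished
   point and its own uniform structure, so it cannot be assumed of the one above. *)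
Definition pm_complete (R : realType) (X : perturbedMetricSpace R) : Prop :=
  forall u : nat -> X, cauchy (u @ \oo) -> exists p : X, u @ \oo --> p.

(* Main.v *)
Require Import Defs.
From mathcomp Require Import all_boot all_order all_algebra.
From mathcomp Require Import boolp classical_sets reals topology.
From mathcomp Require Import normedtype sequences lra.

Import Order.TTheory GRing.Theory Num.Theory.
Import numFieldNormedType.Exports.

Local Open Scope classical_set_scope.
Local Open Scope ring_scope.

(** Write [d] for the exact metric and [a n = D (x n, x (n+1))] along a Picard
    orbit. The Kannan condition gives [a (n+1) <= b / (1 - b) * a n], so [a]
    tends to [0]; applied to two orbit points it also gives
    [d (x (m+1), x (n+1)) <= b * (a m + a n)], so the orbit is Cauchy without
    summing a geometric series. Its limit [p] satisfies
    [(1 - M * b) * d (p, T p) <= d (p, x (n+1)) + b * a n], hence is fixed.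
    The bound [D <= M * d] makes [D (p, p) = 0], and then the Kannan condition
    forces two fixed points to be at distance [0]. *)

Lemma exact_metric_le_pdist (R : realType) (X : perturbedMetricSpace R)
  (x y : X) : exact_metric x y <= pdist x y.
Proof. by rewrite /exact_metric gerBl perturbation_ge0. Qed.

Section Kannan.
Context (R : realType) (X : perturbedMetricSpace R) (T : X -> X) (b : R).
Hypothesis b_ge0 : 0 <= b.
Hypothesis kannan : forall x y : X,
  pdist (T x) (T y) <= b * (pdist x (T x) + pdist y (T y)).

Lemma kannan_displacement_geometric (b_lt1 : b < 1) (x : X) (n : nat) :
  pdist (iter n T x) (iter n.+1 T x) <= pdist x (T x) * (b / (1 - b)) ^+ n.
Proof.
have c_gt0 : 0 < 1 - b by rewrite subr_gt0.
elim: n => [|n IHn]; first by rewrite expr0 mulr1.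
rewrite exprSr mulrA.
have r_ge0 : 0 <= b / (1 - b) by rewrite divr_ge0// ltW.
apply: le_trans (ler_wpM2r r_ge0 IHn).
(* At consecutive iterates the Kannan bound has the new displacement on both sides; [b < 1] lets it
   be absorbed on the left. *)
rewrite mulrA ler_pdivlMr// mulrBr mulr1.
have := kannan (iter n T x) (iter n.+1 T x); rewrite /=; lra.
Qed.

Hypothesis b_lt_half : 2 * b < 1.

Lemma kannan_displacement_cvg0 (x : X) (e : R) (e_gt0 : 0 < e) :
  \forall n \near \oo, pdist (iter n T x) (iter n.+1 T x) < e.
Proof.
have b_lt1 : b < 1 by move: b_ge0 b_lt_half; lra.
have c_gt0 : 0 < 1 - b by lra.
have a_ge0 : 0 <= pdist x (T x) by exact: pdist_ge0.
have r_lt1 : `|b / (1 - b)| < 1.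
  by rewrite ger0_norm ?divr_ge0 ?(ltW c_gt0)// ltr_pdivrMr//; move: b_lt_half; lra.
(* The [+ 1] keeps the divisor positive when the initial displacement vanishes. *)
have c0 : 0 < e / (pdist x (T x) + 1) by rewrite divr_gt0//; lra.
have /cvgrPdist_lt rn_cvg0 := cvg_expr r_lt1.
apply: filterS (rn_cvg0 _ c0) => n; rewrite sub0r normrN => rn_lt.
apply: le_lt_trans (kannan_displacement_geometric b_lt1 x n) _.
have rn_ge0 : 0 <= (b / (1 - b)) ^+ n by rewrite exprn_ge0// divr_ge0// ltW.
move: rn_lt; rewrite ger0_norm// ltr_pdivlMr; last by lra.
by lra.
Qed.

Lemma kannan_orbit_cauchy (x : X) : cauchy (iter n T x @[n --> \oo]).
Proof.
apply: cauchy_exP => e e_gt0.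
have [N _ aN] := kannan_displacement_cvg0 x _ e_gt0.
(* Centre and tail both start at [N.+1], so that every point compared is an image under [T] and the
   Kannan condition applies; both displacements are below [e], and [2 * b < 1] closes the bound. *)
exists (iter N.+1 T x); exists N.+1 => // -[//|n] /= leNn.
rewrite ballEmdist/= mdist_exact.
apply: le_lt_trans (exact_metric_le_pdist _ _ _ _) _.
apply: le_lt_trans (kannan _ _) _.
have /= := aN N (leqnn N); have /= := aN n leNn.
have := pdist_ge0 (iter n T x) (T (iter n T x)).
have := pdist_ge0 (iter N T x) (T (iter N T x)).
by move: b_ge0 b_lt_half; nra.
Qed.

Lemma kannan_orbit_limit_fixed (M : R)
    (D_le : forall x y : X, pdist x y <= M * exact_metric x y)
    (Mb_lt1 : M * b < 1) (x p : X) :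
  iter n T x @[n --> \oo] --> p -> T p = p.
Proof.
move=> xp; apply/esym/(is_metric_eq0 (exact_metricP X)).
apply/eqP; rewrite eq_le (is_metric_ge0 (exact_metricP X)) andbT.
rewrite -/(exact_metric p (T p)).
suff: (1 - M * b) * exact_metric p (T p) <= 0 by rewrite pmulr_rle0// subr_gt0.
apply/ler_addgt0Pl => e e_gt0; rewrite addr0.
have e2_gt0 : 0 < e / 2 by rewrite divr_gt0.
have [N1 _ aN] := kannan_displacement_cvg0 x _ e2_gt0.
have [N2 _ xN] := cvg_ball xp e2_gt0.
pose n := maxn N1 N2.
have /= an := aN n (leq_maxl _ _).
have := xN n.+1 (leqW (leq_maxr _ _)); rewrite ballEmdist/= mdist_exact => dn.
have tri := is_metric_triangle (exact_metricP X) p (T (iter n T x)) (T p).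
have kn := kannan (iter n T x) p.
have dD := exact_metric_le_pdist _ _ (T (iter n T x)) (T p).
(* Kannan leaves the term [b * D (p, T p)]; this turns it into a multiple of [d (p, T p)], absorbed
   by the factor [1 - M * b]. *)
have Dp := D_le p (T p).
have a_ge0 := pdist_ge0 (iter n T x) (T (iter n T x)).
rewrite -!/(exact_metric _ _) in tri.
have bDp := ler_wpM2l b_ge0 Dp.
have ba : b * pdist (iter n T x) (T (iter n T x)) <= e / 2 by move: b_ge0 b_lt_half; nra.
by lra.
Qed.

Lemma kannan_fixed_unique (M : R)
    (D_le : forall x y : X, pdist x y <= M * exact_metric x y) (p q : X) :
  T p = p -> T q = q -> q = p.
Proof.
move=> Tp Tq; apply/(is_metric_eq0 (exact_metricP X)).
apply/eqP; rewrite eq_le (is_metric_ge0 (exact_metricP X)) andbT.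
(* Fixed points have displacement [D (x, x)], which vanishes only because [D] is dominated by
   [M * d]. *)
have Dxx (x : X) : pdist x x <= 0.
  apply: le_trans (D_le x x) _.
  by rewrite /exact_metric (is_metric_eq0 (exact_metricP X) x x).2// mulr0.
apply: le_trans (exact_metric_le_pdist _ _ _ _) _.
have := kannan q p; rewrite Tp Tq => /le_trans; apply.
by rewrite mulr_ge0_le0// -[leRHS]addr0 lerD.
Qed.

End Kannan.

Theorem corollary3p7 (R : realType) (X : perturbedMetricSpace R)
  (X_complete : pm_complete X)
  (M : R) (M_ge1 : 1 <= M)
  (D_le : forall x y : X, pdist x y <= M * exact_metric x y)
  (T : X -> X) (b : R) (b_ge0 : 0 <= b)
  (kannan : forall x y : X,
    pdist (T x) (T y) <= b * (pdist x (T x) + pdist y (T y)))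
  (Mb_lt1 : 2 * M * b < 1) :
  exists p : X,
    [/\ T p = p,
        forall q : X, T q = q -> q = p
      & forall x0 : X, iter n T x0 @[n --> \oo] --> p].
Proof.
(* Since [M >= 1] and [b >= 0], both [2 * b] and [M * b] are at most [2 * M * b]. *)
have b_lt_half : 2 * b < 1 by nra.
have MbR : M * b < 1 by nra.
have orbit_lim (x : X) : exists2 p, T p = p & iter n T x @[n --> \oo] --> p.
  have [p xp] := X_complete _ (kannan_orbit_cauchy _ _ _ _ b_ge0 kannan b_lt_half x).
  exists p => //.
  exact: (kannan_orbit_limit_fixed _ _ _ _ b_ge0 kannan b_lt_half _ D_le MbR _ _ xp).
have uniq_fix := kannan_fixed_unique _ _ _ _ b_ge0 kannan _ D_le.
have [x0 _] := pm_nonempty X.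
have [p Tp _] := orbit_lim x0.
exists p; split => // [q|x]; first exact: uniq_fix.
(* Each orbit has its own fixed limit; uniqueness identifies it with [p]. *)
by have [q Tq xq] := orbit_lim x; rewrite -(uniq_fix _ _ Tp Tq).
Qed.
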